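(* Let $R$ be a commutative reduced ring and $Q$ its quotient ring. Assume that the space $\mathrm{Min}\ R$ of minimal prime ideals of $R$ is compact in its Zariski topology. Then the following conditions are equivalent: (1) $Q$ is semisimple; (2) each flat $R$-module is semi-compact; (3) each flat $R$-module is finitely projective; (4) each flat $R$-module is singly projective.
   Context: Rings are associative with identity and modules are unitary. The quotient ring of a commutative ring $R$ is its total ring of fractions (localization at the set of all regular elements). For an $R$-module $M$ and an ideal $I$, $M[I]=\{m\in M\mid Im=0\}$. $M$ is semi-compact if every set of congruences $x\equiv x_\alpha\pmod{M[I_\alpha]}$ ($\alpha\in\Lambda$, $x_\alpha\in M$, $I_\alpha$ an ideal of $R$), each finite subset of which has a common solution in $M$, has a simultaneous solution in $M$. $M$ is finitely projective (respectively singly projective) if every homomorphism from a finitely generated (respectively cyclic) $R$-module into $M$ factors through a free $R$-module. *)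

(* Defs.v *)
From HB Require Import structures.
From mathcomp Require Import all_boot all_order all_algebra.
From mathcomp Require Import all_classical topology.

Set Implicit Arguments.
Unset Strict Implicit.
Unset Printing Implicit Defensive.

Import GRing.Theory.
Local Open Scope classical_set_scope.
Local Open Scope quotient_scope.
Local Open Scope ring_scope.

(* Rings are comPzRingType: commutative, with identity, possibly zero.  The   *)
(* choice structure carried by rings and modules is no restriction, since     *)
(* boolp provides one on every type.                                          *)

Definition submodule (R : pzRingType) (V : lmodType R) (N : set V) :=
  N 0 /\ forall (a : R) (u v : V), N u -> N v -> N (a *: u + v).

(* The improper ideal is allowed; ring_quotient's idealr_closed excludes it.  *)
Definition ideal (R : comPzRingType) (I : set R) :=
  submodule (I : set (R^o : lmodType R)).

Definition reduced (R : comPzRingType) :=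
  forall (x : R) (n : nat), x ^+ n = 0 -> x = 0.

Section Spectrum.
Variable R : comPzRingType.

Definition prime_ideal (P : set R) :=
  [/\ ideal P, ~ P 1 & forall a b : R, P (a * b) -> P a \/ P b].

Record spectrum := Spectrum {
  spec_ideal :> set R ;
  spec_prime : prime_ideal spec_ideal
}.

HB.instance Definition _ := gen_eqMixin spectrum.
HB.instance Definition _ := gen_choiceMixin spectrum.

(* The complements of the sets V(E), for E a subset of R.                     *)
Definition zariski_open : set_system spectrum :=
  [set U | exists E : set R, U = [set P : spectrum | ~ (E `<=` P)]].

Lemma zariski_openT : zariski_open setT.
Proof.
exists [set 1]; apply/seteqP; split=> P //= _ P1.
by case: (spec_prime P) => _ + _; apply; apply: P1.
Qed.

Lemma zariski_openI : setI_closed zariski_open.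
Proof.
move=> _ _ [E ->] [F ->].
exists [set x | exists a b, [/\ E a, F b & x = a * b]].
have idl (P : spectrum) (a b : R) : spec_ideal P b -> spec_ideal P (a * b).
  move=> Pb; have [[P0 Plin] _ _] := spec_prime P.
  by have := Plin a b 0 Pb P0; rewrite addr0.
apply/seteqP; split=> P /=.
  move=> [nE nF] sub.
  case: (pselect (exists2 a, E a & ~ spec_ideal P a)) => [[a Ea nPa]|nex]; last first.
    apply: nE => a Ea.
    by case: (pselect (spec_ideal P a)) => // nPa; case: nex; exists a.
  apply: nF => b Fb; have [_ _ Pm] := spec_prime P.
  by case: (Pm a b _) => //; apply: sub; exists a, b.
move=> n; split=> sub; apply: n => _ [a [b [Ea Fb ->]]].
  by rewrite mulrC; apply: idl; apply: sub.
by apply: idl; apply: sub.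
Qed.

Lemma zariski_open_bigcup (I : Type) (f : I -> set spectrum) :
  (forall i, zariski_open (f i)) -> zariski_open (\bigcup_i f i).
Proof.
move=> /choice[E fE]; exists (\bigcup_i E i).
apply/seteqP; split=> P /=.
  move=> [i _]; rewrite fE /= => nsub sub; apply: nsub => x Ex.
  by apply: sub; exists i.
move=> nsub; apply: contrapT => nU; apply: nsub => x [i _ Ex].
apply: contrapT => nPx; apply: nU; exists i => //.
by rewrite fE /= => sub; apply: nPx; apply: sub.
Qed.

HB.instance Definition _ := isOpenTopological.Build spectrum
  zariski_openT zariski_openI zariski_open_bigcup.

Lemma open_spectrumE (U : set spectrum) : open U = zariski_open U.
Proof. by []. Qed.

Definition minimal_primes : set spectrum :=
  [set P : spectrum | forall P' : spectrum, P' `<=` P -> P `<=` P'].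

End Spectrum.

(* The localization of R at the set of all its regular elements.              *)
Section TotalFractions.
Variable R : comPzRingType.

Definition regular_elt := {s : R | `[< GRing.lreg s >]}.

Lemma regularP (s : regular_elt) : GRing.lreg (val s).
Proof. exact/asboolP/(valP s). Qed.

Lemma regular1_subproof : `[< GRing.lreg (1 : R) >].
Proof. exact/asboolP/lreg1. Qed.
Definition regular1 : regular_elt := Sub (1 : R) regular1_subproof.

Lemma regularM_subproof (s t : regular_elt) : `[< GRing.lreg (val s * val t) >].
Proof. by apply/asboolP; apply: lregM; apply: regularP. Qed.
Definition regularM s t : regular_elt := Sub (val s * val t) (regularM_subproof s t).

Definition frac_eq (x y : R * regular_elt) : bool :=
  x.1 * val y.2 == y.1 * val x.2.

Lemma frac_eq_equiv : equiv_class_of frac_eq.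
Proof.
split=> [x|x y|y x z].
- exact: eqxx.
- by rewrite /frac_eq eq_sym.
- rewrite /frac_eq => /eqP xy /eqP yz; apply/eqP/(@regularP y.2).
  by rewrite mulrCA mulrA xy mulrAC yz [RHS]mulrCA mulrA.
Qed.

Canonical frac_eq_rel := EquivRelPack frac_eq_equiv.

Definition total_fractions := {eq_quot frac_eq_rel}.
HB.instance Definition _ := Choice.on total_fractions.

Definition frac (a : R) (s : regular_elt) : total_fractions :=
  \pi_total_fractions (a, s).

Lemma fracE (a b : R) (s t : regular_elt) :
  frac a s = frac b t <-> a * val t = b * val s.
Proof.
split=> [/eqmodP/eqP//|e]; exact/eqmodP/eqP.
Qed.

Lemma frac_ind (P : total_fractions -> Prop) :
  (forall a s, P (frac a s)) -> forall x, P x.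
Proof. by move=> h x; rewrite -[x]reprK; case: (repr x). Qed.

Definition frac_add (x y : total_fractions) : total_fractions :=
  let: (a, s) := repr x in let: (b, t) := repr y in
  frac (a * val t + b * val s) (regularM s t).
Definition frac_opp (x : total_fractions) : total_fractions :=
  let: (a, s) := repr x in frac (- a) s.
Definition frac_mul (x y : total_fractions) : total_fractions :=
  let: (a, s) := repr x in let: (b, t) := repr y in
  frac (a * b) (regularM s t).

Lemma repr_frac (a : R) (s : regular_elt) :
  (repr (frac a s)).1 * val s = a * val (repr (frac a s)).2.
Proof. by apply/fracE; rewrite -[RHS]reprK /frac; case: (repr _). Qed.

Lemma frac_addE a s b t :
  frac_add (frac a s) (frac b t) =
  frac (a * val t + b * val s) (regularM s t).
Proof.
rewrite /frac_add; move: (repr_frac a s) (repr_frac b t).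
case: (repr _) => a' s'; case: (repr _) => b' t' /= ea eb.
apply/fracE => /=; rewrite !mulrDl; congr (_ + _).
  by rewrite mulrACA ea [RHS]mulrACA (mulrC (val t)).
rewrite (mulrC (val s)) mulrACA eb [in RHS](mulrC (val s')) [RHS]mulrACA.
by rewrite (mulrC (val s')).
Qed.

Lemma frac_oppE a s : frac_opp (frac a s) = frac (- a) s.
Proof.
rewrite /frac_opp; move: (repr_frac a s); case: (repr _) => a' s' /= e.
by apply/fracE; rewrite !mulNr e.
Qed.

Lemma frac_mulE a s b t :
  frac_mul (frac a s) (frac b t) = frac (a * b) (regularM s t).
Proof.
rewrite /frac_mul; move: (repr_frac a s) (repr_frac b t).
case: (repr _) => a' s'; case: (repr _) => b' t' /= ea eb.
by apply/fracE => /=; rewrite mulrACA ea eb mulrACA.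
Qed.

Fact frac_addA : associative frac_add.
Proof.
elim/frac_ind=> a s; elim/frac_ind=> b t; elim/frac_ind=> c u.
rewrite !frac_addE; apply/fracE => /=; rewrite -!mulrA; congr (_ * _).
by rewrite !mulrDl -!mulrA addrA (mulrC (val u)) (mulrC (val t) (val s)).
Qed.

Fact frac_addC : commutative frac_add.
Proof.
elim/frac_ind=> a s; elim/frac_ind=> b t; rewrite !frac_addE; apply/fracE => /=.
by rewrite addrC (mulrC (val s)).
Qed.

Fact frac_add0 : left_id (frac 0 regular1) frac_add.
Proof.
elim/frac_ind=> a s; rewrite frac_addE; apply/fracE => /=.
by rewrite mul0r add0r mulr1 mul1r.
Qed.

Fact frac_addN : left_inverse (frac 0 regular1) frac_opp frac_add.
Proof.
elim/frac_ind=> a s; rewrite frac_oppE frac_addE; apply/fracE => /=.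
by rewrite mulNr addNr !mul0r.
Qed.

HB.instance Definition _ :=
  GRing.isZmodule.Build total_fractions frac_addA frac_addC frac_add0 frac_addN.

Fact frac_mulA : associative frac_mul.
Proof.
elim/frac_ind=> a s; elim/frac_ind=> b t; elim/frac_ind=> c u.
by rewrite !frac_mulE; apply/fracE; rewrite /= !mulrA.
Qed.

Fact frac_mulC : commutative frac_mul.
Proof.
elim/frac_ind=> a s; elim/frac_ind=> b t; rewrite !frac_mulE; apply/fracE => /=.
by rewrite (mulrC a) (mulrC (val s)).
Qed.

Fact frac_mul1 : left_id (frac 1 regular1) frac_mul.
Proof.
by elim/frac_ind=> a s; rewrite frac_mulE; apply/fracE; rewrite /= !mul1r.
Qed.

Fact frac_mulD : left_distributive frac_mul frac_add.
Proof.
elim/frac_ind=> a s; elim/frac_ind=> b t; elim/frac_ind=> c u.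
rewrite !(frac_mulE, frac_addE); apply/fracE => /=.
rewrite !mulrDl; congr (_ + _); rewrite -!mulrA; congr (_ * _).
  by rewrite !(mulrCA (val t)); congr (_ * _); rewrite !(mulrCA (val s)) mulrCA.
by rewrite !(mulrCA (val s)); congr (_ * _); rewrite !(mulrCA (val t)) mulrCA.
Qed.

HB.instance Definition _ := GRing.Zmodule_isComPzRing.Build total_fractions
  frac_mulA frac_mulC frac_mul1 frac_mulD.

Lemma fracD a s b t :
  frac a s + frac b t = frac (a * val t + b * val s) (regularM s t).
Proof. exact: frac_addE. Qed.

Lemma fracM a s b t : frac a s * frac b t = frac (a * b) (regularM s t).
Proof. exact: frac_mulE. Qed.

Lemma frac_inv (s : regular_elt) : frac (val s) regular1 * frac 1 s = 1.
Proof. by rewrite fracM; apply/fracE; rewrite /= !mulr1 !mul1r. Qed.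

End TotalFractions.

(* Every submodule is a direct summand (Lam, A First Course in Noncommutative *)
(* Rings, 2.1).                                                               *)
Definition semisimple_module (R : pzRingType) (V : lmodType R) :=
  forall N : set V, submodule N ->
    exists N' : set V, [/\ submodule N',
      forall v, N v -> N' v -> v = 0
    & forall v, exists u u', [/\ N u, N' u' & v = u + u']].

Definition semisimple_ring (R : pzRingType) :=
  semisimple_module (R^o : lmodType R).

(* A (x)_R M, as formal finite sums of pairs (a, m) modulo the congruence     *)
(* generated by the bilinearity relations; tensor_universal below checks the  *)
(* universal property.                                                        *)
Section Tensor.
Variables (R : comPzRingType) (A M : lmodType R).

Inductive tensor_cong : seq (A * M) -> seq (A * M) -> Prop :=
| tcong_refl s : tensor_cong s s
| tcong_sym s t : tensor_cong s t -> tensor_cong t s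
| tcong_trans s t u : tensor_cong s t -> tensor_cong t u -> tensor_cong s u
| tcong_cat s s' t t' :
    tensor_cong s s' -> tensor_cong t t' -> tensor_cong (s ++ t) (s' ++ t')
| tcong_catC s t : tensor_cong (s ++ t) (t ++ s)
| tcong_0l m : tensor_cong [:: (0, m)] [::]
| tcong_Dl a a' m : tensor_cong [:: (a + a', m)] [:: (a, m); (a', m)]
| tcong_Dr a m m' : tensor_cong [:: (a, m + m')] [:: (a, m); (a, m')]
| tcong_Z (r : R) a m : tensor_cong [:: (r *: a, m)] [:: (a, r *: m)].

Definition tensor_congb s t := `[< tensor_cong s t >].

Lemma tensor_cong_equiv : equiv_class_of tensor_congb.
Proof.
split=> [s|s t|t s u].
- exact/asboolP/tcong_refl.
- by apply/asboolP/asboolP; apply: tcong_sym.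
- by move=> /asboolP st /asboolP tu; apply/asboolP; apply: tcong_trans st tu.
Qed.

Canonical tensor_cong_rel := EquivRelPack tensor_cong_equiv.

Definition tensor := {eq_quot tensor_cong_rel}.
HB.instance Definition _ := Choice.on tensor.

Definition tensor_of (s : seq (A * M)) : tensor := \pi_tensor s.
Definition pure_tensor (a : A) (m : M) : tensor := tensor_of [:: (a, m)].

Lemma tensor_ofE s t : tensor_of s = tensor_of t <-> tensor_cong s t.
Proof. by split=> [/eqmodP/asboolP|h] //; apply/eqmodP/asboolP. Qed.

Lemma tensor_of_ind (P : tensor -> Prop) :
  (forall s, P (tensor_of s)) -> forall x, P x.
Proof. by move=> h x; rewrite -[x]reprK; apply: h. Qed.

Lemma repr_tensor_of s : tensor_cong (repr (tensor_of s)) s.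
Proof. by apply/tensor_ofE; rewrite {1}/tensor_of reprK. Qed.

Definition formal_scale (r : R) (s : seq (A * M)) :=
  [seq (r *: x.1, x.2) | x <- s].

Lemma formal_scale_cong r s t :
  tensor_cong s t -> tensor_cong (formal_scale r s) (formal_scale r t).
Proof.
elim=> {s t} [s|s t _|s t u _ + _|s s' t t' _ ss' _ tt'|s t|m|a a' m|a m m'|r' a m].
- exact: tcong_refl.
- exact: tcong_sym.
- exact: tcong_trans.
- by rewrite /formal_scale !map_cat; apply: tcong_cat.
- by rewrite /formal_scale !map_cat; apply: tcong_catC.
- by rewrite /= scaler0; apply: tcong_0l.
- by rewrite /= scalerDr; apply: tcong_Dl.
- exact: tcong_Dr.
- by rewrite /= scalerA mulrC -scalerA; apply: tcong_Z.
Qed.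

Definition tensor_add (x y : tensor) := tensor_of (repr x ++ repr y).
Definition tensor_scale (r : R) (x : tensor) :=
  tensor_of (formal_scale r (repr x)).
Definition tensor_opp (x : tensor) := tensor_scale (-1) x.

Lemma tensor_addE s t :
  tensor_add (tensor_of s) (tensor_of t) = tensor_of (s ++ t).
Proof. by apply/tensor_ofE/tcong_cat; apply: repr_tensor_of. Qed.

Lemma tensor_scaleE r s :
  tensor_scale r (tensor_of s) = tensor_of (formal_scale r s).
Proof. exact/tensor_ofE/formal_scale_cong/repr_tensor_of. Qed.

Lemma formal_scaleD (r r' : R) s :
  tensor_cong (formal_scale (r + r') s) (formal_scale r s ++ formal_scale r' s).
Proof.
elim: s => [|[a m] s IHs] /=; first exact: tcong_refl.
rewrite -[X in tensor_cong X]cat1s scalerDl.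
apply: tcong_trans (tcong_cat (tcong_Dl _ _ _) IHs) _.
rewrite -cat1s -[X in tensor_cong _ X]cat1s /= -!(cat1s _ (_ ++ _)).
apply: tcong_cat (tcong_refl _) _.
rewrite catA -(cat1s _ (formal_scale r' s)) !catA.
exact: tcong_cat (tcong_catC _ _) (tcong_refl _).
Qed.

Fact tensor_addA : associative tensor_add.
Proof.
elim/tensor_of_ind=> s; elim/tensor_of_ind=> t; elim/tensor_of_ind=> u.
by rewrite !tensor_addE catA.
Qed.

Fact tensor_addC : commutative tensor_add.
Proof.
elim/tensor_of_ind=> s; elim/tensor_of_ind=> t.
by rewrite !tensor_addE; apply/tensor_ofE/tcong_catC.
Qed.

Fact tensor_add0 : left_id (tensor_of [::]) tensor_add.
Proof. by elim/tensor_of_ind=> s; rewrite tensor_addE. Qed.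

Lemma formal_scale0 s : tensor_cong (formal_scale 0 s) [::].
Proof.
elim: s => [|[a m] s IHs] /=; first exact: tcong_refl.
by rewrite -cat1s scale0r; apply: (tcong_cat (tcong_0l m) IHs).
Qed.

Lemma formal_scale1 s : formal_scale 1 s = s.
Proof. by elim: s => [|[a m] s IHs] //=; rewrite scale1r IHs. Qed.

Fact tensor_addN : left_inverse (tensor_of [::]) tensor_opp tensor_add.
Proof.
elim/tensor_of_ind=> s; rewrite /tensor_opp tensor_scaleE tensor_addE.
apply/tensor_ofE; rewrite -{2}[s]formal_scale1.
apply: tcong_trans (tcong_sym (formal_scaleD _ _ _)) _.
by rewrite addNr; apply: formal_scale0.
Qed.

HB.instance Definition _ :=
  GRing.isZmodule.Build tensor tensor_addA tensor_addC tensor_add0 tensor_addN.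

Lemma tensor_ofD s t : tensor_of (s ++ t) = tensor_of s + tensor_of t.
Proof. by rewrite -tensor_addE. Qed.

Fact tensor_scaleA a b v :
  tensor_scale a (tensor_scale b v) = tensor_scale (a * b) v.
Proof.
elim/tensor_of_ind: v => s; rewrite !tensor_scaleE /formal_scale -map_comp.
by congr tensor_of; apply: eq_map => x /=; rewrite scalerA.
Qed.

Fact tensor_scale1 : left_id 1 tensor_scale.
Proof. by elim/tensor_of_ind=> s; rewrite tensor_scaleE formal_scale1. Qed.

Fact tensor_scaleDr : right_distributive tensor_scale +%R.
Proof.
move=> a; elim/tensor_of_ind=> s; elim/tensor_of_ind=> t.
by rewrite -tensor_ofD !tensor_scaleE -tensor_ofD /formal_scale map_cat.
Qed.

Fact tensor_scaleDl v : {morph tensor_scale^~ v : a b / a + b}.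
Proof.
move=> a b; elim/tensor_of_ind: v => s; rewrite !tensor_scaleE -tensor_ofD.
exact/tensor_ofE/formal_scaleD.
Qed.

HB.instance Definition _ := GRing.Zmodule_isLmodule.Build R tensor
  tensor_scaleA tensor_scale1 tensor_scaleDr tensor_scaleDl.

Lemma tensor_ofZ (r : R) s : tensor_of (formal_scale r s) = r *: tensor_of s.
Proof. by rewrite -tensor_scaleE. Qed.

Lemma tensor_of_sum s :
  tensor_of s = \sum_(x <- s) pure_tensor x.1 x.2.
Proof.
elim: s => [|[a m] s IHs]; first by rewrite big_nil.
by rewrite big_cons -cat1s tensor_ofD IHs.
Qed.

Lemma tensor_universal (N : lmodType R) (b : A -> M -> N) :
  (forall a, linear (b a)) -> (forall m, linear (b^~ m)) ->
  exists g : {linear tensor -> N},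
    (forall a m, g (pure_tensor a m) = b a m) /\
    (forall g' : {linear tensor -> N},
      (forall a m, g' (pure_tensor a m) = b a m) -> g' =1 g).
Proof.
move=> br bl; pose ev s := \sum_(x <- s) b x.1 x.2.
have bDl a a' m : b (a + a') m = b a m + b a' m.
  by have := bl m 1 a a'; rewrite !scale1r.
have bDr a m m' : b a (m + m') = b a m + b a m'.
  by have := br a 1 m m'; rewrite !scale1r.
have b0l m : b 0 m = 0.
  by apply: (addIr (b 0 m)); rewrite -bDl !add0r.
have b0r a : b a 0 = 0.
  by apply: (addIr (b a 0)); rewrite -bDr !add0r.
have bZl r a m : b (r *: a) m = r *: b a m.
  by have := bl m r a 0; rewrite addr0 b0l addr0.
have bZr r a m : b a (r *: m) = r *: b a m.
  by have := br a r m 0; rewrite addr0 b0r addr0.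
have ev_cat s t : ev (s ++ t) = ev s + ev t by rewrite /ev big_cat.
have ev_cong s t : tensor_cong s t -> ev s = ev t.
  elim=> {s t} [//|//|s t u _ -> //|s s' t t' _ e _ e'|s t|m|a a' m|a m m'|r a m].
  - by rewrite !ev_cat e e'.
  - by rewrite !ev_cat addrC.
  - by rewrite /ev big_seq1 big_nil b0l.
  - by rewrite /ev !big_cons !big_nil /= bDl !addr0.
  - by rewrite /ev !big_cons !big_nil /= bDr !addr0.
  - by rewrite /ev !big_seq1 /= bZl bZr.
pose g (x : tensor) := ev (repr x).
have gE s : g (tensor_of s) = ev s by apply/ev_cong/repr_tensor_of.
have glin : linear g.
  move=> r; elim/tensor_of_ind=> s; elim/tensor_of_ind=> t.
  rewrite -tensor_ofZ -tensor_ofD !gE ev_cat; congr (_ + _).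
  rewrite /ev scaler_sumr big_map; apply: eq_bigr => x _ /=; exact: bZl.
pose gL := GRing.isLinear.Build R tensor N *:%R g glin.
pose gl : {linear tensor -> N} := HB.pack g gL.
exists gl; split=> [a m|g' g'E]; first by rewrite /= gE /ev big_seq1.
elim/tensor_of_ind=> s; rewrite /= gE tensor_of_sum raddf_sum.
by apply: eq_bigr => x _; apply: g'E.
Qed.

End Tensor.

(* f (x) id_M *)
Definition tensor_map (R : comPzRingType) (A B M : lmodType R)
    (f : {linear A -> B}) (x : tensor A M) : tensor B M :=
  tensor_of [seq (f y.1, y.2) | y <- repr x].

Lemma tensor_mapE (R : comPzRingType) (A B M : lmodType R)
    (f : {linear A -> B}) (s : seq (A * M)) :
  tensor_map f (tensor_of s) = tensor_of [seq (f y.1, y.2) | y <- s].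
Proof.
apply/tensor_ofE; have := repr_tensor_of s; move: (repr _) => t.
elim=> {s t} [s|s t _|s t u _ + _|s s' t t' _ ss' _ tt'|s t|m|a a' m|a m m'|r a m].
- exact: tcong_refl.
- exact: tcong_sym.
- exact: tcong_trans.
- by rewrite !map_cat; apply: tcong_cat.
- by rewrite !map_cat; apply: tcong_catC.
- by rewrite /= raddf0; apply: tcong_0l.
- by rewrite /= raddfD; apply: tcong_Dl.
- exact: tcong_Dr.
- by rewrite /= linearZ; apply: tcong_Z.
Qed.

Lemma tensor_map_pure (R : comPzRingType) (A B M : lmodType R)
    (f : {linear A -> B}) (a : A) (m : M) :
  tensor_map f (pure_tensor a m) = pure_tensor (f a) m.
Proof. exact: tensor_mapE. Qed.

Section Modules.
Variable R : comPzRingType.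

Definition flat (M : lmodType R) :=
  forall (A B : lmodType R) (f : {linear A -> B}),
    injective f -> injective (tensor_map f : tensor A M -> tensor B M).

Definition annihilated_by (M : lmodType R) (I : set R) : set M :=
  [set m | forall a, I a -> a *: m = 0].

Definition semi_compact (M : lmodType R) :=
  forall (L : Type) (I : L -> set R) (x : L -> M),
    (forall l, ideal (I l)) ->
    (forall F : set L, finite_set F ->
      exists y : M, forall l, F l -> annihilated_by (I l) (y - x l)) ->
    exists y : M, forall l, annihilated_by (I l) (y - x l).

Definition finitely_generated (N : lmodType R) :=
  exists (n : nat) (g : 'I_n -> N),
    forall x, exists c : 'I_n -> R, x = \sum_i c i *: g i.

Definition cyclic_module (N : lmodType R) :=
  exists g : N, forall x, exists r : R, x = r *: g.

Definition is_basis (F : lmodType R) (I : choiceType) (b : I -> F) :=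
  (forall (s : seq I) (c : I -> R), uniq s ->
     \sum_(i <- s) c i *: b i = 0 -> forall i, i \in s -> c i = 0) /\
  (forall x : F, exists (s : seq I) (c : I -> R), x = \sum_(i <- s) c i *: b i).

Definition free_module (F : lmodType R) :=
  exists (I : choiceType) (b : I -> F), is_basis b.

Definition factors_through_free (N M : lmodType R) (f : {linear N -> M}) :=
  exists (F : lmodType R) (g : {linear N -> F}) (h : {linear F -> M}),
    free_module F /\ f =1 h \o g.

Definition finitely_projective (M : lmodType R) :=
  forall N : lmodType R, finitely_generated N ->
    forall f : {linear N -> M}, factors_through_free f.

Definition singly_projective (M : lmodType R) :=
  forall N : lmodType R, cyclic_module N ->
    forall f : {linear N -> M}, factors_through_free f.

End Modules.

(* Main.v *)
From HB Require Import structures.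
From mathcomp Require Import all_boot all_order all_algebra.
From mathcomp Require Import all_classical topology.
From mathcomp Require Import ring.
Require Import Defs.

(** Everything goes through a condition on ideals of R alone.  Call the
    ideals of R split if every ideal I contains an a with b s = b a for all b
    in I and some fixed regular s.  Then a / s is an idempotent generator of
    the extension of I to Q, and conversely a direct complement of that
    extension produces such a pair; so the ideals of R split exactly when Q
    is semisimple (semisimple_ideals_split, ideals_split_semisimple).

    Suppose that the ideals split.  Regular elements act injectively on a
    flat module M, so for m in M, being killed by I amounts to being killed
    by the single element a of I.  Given congruences modulo the M[I_l],
    apply this to an ideal containing all I_l, each element of which is
    accounted for by finitely many of them: a depends on finitely many
    indices only, and a solution for those indices solves all the congruences
    (flat_semi_compact).  In the same way every submodule of R^n is, up to
    regular multiples, finitely generated; the equational criterion for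
    flatness then lets a map from R^n to M factor through some R^p so that
    any given submodule of its kernel, even one that is not finitely
    generated, dies in R^p (flat_finitely_projective).

    For the converses, a reduced ring whose ideals do not split contains an
    infinite sequence d of nonzero elements with pairwise zero products
    (no_orthogonal_sequence_split).  Such a sequence is incompatible with
    semi-compactness of all flat modules and, Min R being compact, with their
    single projectivity.  Over the free module with basis e_0, e_1, ..., the
    system d_n y = d_n^2 e_n is finitely solvable, but each coordinate of a
    global solution would be nonzero (semi_compact_no_orthogonal).  As for
    single projectivity, let P be a minimal prime.  The localization R_P is
    flat, and the annihilator of its element 1 is P because R is reduced;
    single projectivity gives a b outside P that kills P, which makes P an
    isolated point of Min R (minimal_prime_isolated).  Now choose minimal
    primes P_n with d_n outside P_n, and a cluster point Q of them, by
    compactness.  As Q is isolated, d_n lies outside Q for infinitely many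
    n, although the product of two of them is 0
    (compact_isolated_no_orthogonal). *)

Set Implicit Arguments.
Unset Strict Implicit.
Unset Printing Implicit Defensive.

Import GRing.Theory.
Local Open Scope classical_set_scope.
Local Open Scope quotient_scope.
Local Open Scope ring_scope.

(** * Submodules *)

Section SubmoduleTheory.
Variables (R : pzRingType) (V : lmodType R) (N : set V).
Hypothesis N_sub : submodule N.

Lemma submod0 : N 0. Proof. by case: N_sub. Qed.

Lemma submodZD a u v : N u -> N v -> N (a *: u + v).
Proof. by case: N_sub => _; apply. Qed.

Lemma submodD u v : N u -> N v -> N (u + v).
Proof. by move=> Nu Nv; rewrite -[u]scale1r; apply: submodZD. Qed.

Lemma submodZ a u : N u -> N (a *: u).
Proof. by move=> Nu; rewrite -[X in N X]addr0; apply: submodZD Nu submod0. Qed.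

Lemma submodN u : N u -> N (- u).
Proof. by rewrite -scaleN1r; apply: submodZ. Qed.

Lemma submodB u v : N u -> N v -> N (u - v).
Proof. by move=> Nu /submodN; apply: submodD. Qed.

Lemma submod_sum (J : Type) (r : seq J) (P : pred J) (F : J -> V) :
  (forall i, P i -> N (F i)) -> N (\sum_(i <- r | P i) F i).
Proof.
by move=> NF; apply: big_ind => //; [exact: submod0 | exact: submodD].
Qed.

End SubmoduleTheory.

Section SubmoduleType.
Variables (R : pzRingType) (V : lmodType R) (N : set V).

(** The closure proof is an argument so that the structure instances below
    can be inferred from the predicate. *)
Definition submod_mem of submodule N : {pred V} := fun v => `[< N v >].

Variable N_sub : submodule N.

Fact submod_mem_closed : submod_closed (submod_mem N_sub).
Proof.
split=> [|a u v /asboolP Nu /asboolP Nv]; apply/asboolP.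
  exact: (submod0 N_sub).
exact: (submodZD N_sub).
Qed.
HB.instance Definition _ :=
  GRing.isSubmodClosed.Build R V (submod_mem N_sub) submod_mem_closed.

Definition submod_type := {v | v \in submod_mem N_sub}.
HB.instance Definition _ := SubChoice.on submod_type.
HB.instance Definition _ := [SubChoice_isSubLmodule of submod_type by <:].

Lemma submod_typeP (x : submod_type) : N (\val x).
Proof. exact/asboolP/(valP x). Qed.

Definition submod_elt v (Nv : N v) : submod_type := Sub v (asboolT Nv).

End SubmoduleType.

(** * Ideals of a ring and of its total ring of fractions *)

Section Splitting.
Variable R : comPzRingType.

Lemma lreg_eq0 (s x : R) : GRing.lreg s -> s * x = 0 -> x = 0.
Proof. by move=> sreg sx; apply: sreg; rewrite sx mulr0. Qed.

Lemma lregPn (s : R) : ~ GRing.lreg s -> exists2 z, z != 0 & s * z = 0.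
Proof.
move=> ns; apply: contrapT => nz; apply: ns => x y e.
apply/eqP; rewrite -subr_eq0; apply: contrapT => /negP xy.
by apply: nz; exists (x - y); rewrite // mulrBr e subrr.
Qed.

Lemma idealM (I : set R) : ideal I -> forall a x, I x -> I (a * x).
Proof. by move=> I_id a x; apply: (submodZ I_id). Qed.

(** In the total ring of fractions this says that a / s is an idempotent
    generating the extension of I; stated in R, it can be used without
    leaving R. *)
Definition ideals_split :=
  forall I : set R, ideal I ->
    exists a s, [/\ I a, GRing.lreg s & forall b, I b -> b * s = b * a].

(** Splitting 1 along the extension of I and a complement gives 1 = a / s + u
    with a in I; for b in I, the product b u lies in both summands, hence
    vanishes, and b = b a / s. *)
Lemma semisimple_ideals_split :
  semisimple_ring (total_fractions R) -> ideals_split.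
Proof.
move=> Qss I I_id.
pose N : set (total_fractions R) :=
  [set v | exists2 a, I a & exists s, v = frac a s].
have N_sub : submodule (N : set ((total_fractions R)^o : lmodType _)).
  split; first by exists 0; [exact: (submod0 I_id) | exists (regular1 R)].
  move=> x u v [a Ia [s ->]] [b Ib [t ->]].
  elim/frac_ind: x => c r; rewrite /= /GRing.scale /= fracM fracD.
  eexists; last by eexists.
  by apply: (submodD I_id); rewrite mulrC; apply: (idealM I_id) => //;
    apply: idealM.
have [N' [N'_sub disj dec]] := Qss _ N_sub.
have [_ [u' [[a Ia [s ->]] N'u' e1]]] := dec 1.
exists a, (val s); split => //; first exact: regularP.
move=> b Ib.
have b_u' : frac b (regular1 R) * u' =
    frac b (regular1 R) - frac b (regular1 R) * frac a s.
  by rewrite -[X in X - _]mulr1 -mulrBr e1 addrC addKr.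
have : frac b (regular1 R) * u' = 0.
  apply: disj; last exact: (submodZ N'_sub).
  rewrite b_u'; apply: (submodB N_sub).
    by exists b => //; exists (regular1 R).
  rewrite fracM; eexists; last by eexists.
  exact: (idealM I_id).
rewrite b_u' fracM => /eqP; rewrite subr_eq0 => /eqP/fracE /=.
by rewrite mul1r mulr1.
Qed.

(** Applied to the contraction of N to R, the splitting gives an idempotent e
    in N acting as the identity on N; the annihilator of e is then a
    complement. *)
Lemma ideals_split_semisimple :
  ideals_split -> semisimple_ring (total_fractions R).
Proof.
move=> split_R N N_sub.
pose I : set R := [set a | N (frac a (regular1 R))].
have NM x v : N v -> N (x * v) by move=> Nv; apply: (submodZ N_sub).
have I_id : ideal I.
  split=> [|a x y Ix Iy]; first exact: (submod0 N_sub).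
  rewrite /I /=; have -> : @frac R (a *: (x : R^o) + y) (regular1 R) =
      @frac R a (regular1 R) * @frac R x (regular1 R) + @frac R y (regular1 R).
    by rewrite fracM fracD; apply/fracE; rewrite /= !mulr1.
  by apply: (submodD N_sub) => //; apply: NM.
have [a [s [Ia s_reg sE]]] := split_R _ I_id.
pose e := frac a (Sub s (asboolT s_reg)).
have Ne : N e.
  have -> : e = frac 1 (Sub s (asboolT s_reg)) * frac a (regular1 R).
    by rewrite fracM; apply/fracE; rewrite /= mulr1 mul1r.
  exact: NM.
have eE v : N v -> v * e = v.
  elim/frac_ind: v => b t Nb.
  have Ib : I b.
    have := NM (frac (val t) (regular1 R)) _ Nb; congr N.
    by rewrite fracM; apply/fracE; rewrite /= mulr1 mul1r mulrC.
  by rewrite fracM; apply/fracE; rewrite /= -sE // mulrAC mulrA.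
exists [set v | v * e = 0]; split.
- split=> [|x u v /= ue ve]; first exact: mul0r.
  by rewrite mulrDl ve addr0 -mulrA ue mulr0.
- by move=> v Nv /= ve; rewrite -(eE _ Nv).
- move=> v; exists (v * e), (v - v * e); split; first exact: NM.
    by rewrite /= mulrBl -mulrA (eE _ Ne) subrr.
  by rewrite addrC subrK.
Qed.

End Splitting.

(** * Tensor products *)

Section TensorTheory.
Variables (R : comPzRingType) (A M : lmodType R).
Implicit Types (a b : A) (m : M) (x y : tensor A M).

Lemma pure_tensorZ (r : R) a m :
  pure_tensor (r *: a) m = pure_tensor a (r *: m).
Proof. exact/tensor_ofE/tcong_Z. Qed.

Lemma pure_tensorZr (r : R) a m : pure_tensor a (r *: m) = r *: pure_tensor a m.
Proof. by rewrite -pure_tensorZ -tensor_ofZ. Qed.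

Lemma pure_tensorDr a m m' :
  pure_tensor a (m + m') = pure_tensor a m + pure_tensor a m'.
Proof. by rewrite -tensor_ofD; apply/tensor_ofE/tcong_Dr. Qed.

Lemma pure_tensorDl a a' m :
  pure_tensor (a + a') m = pure_tensor a m + pure_tensor a' m.
Proof. by rewrite -tensor_ofD; apply/tensor_ofE/tcong_Dl. Qed.

Lemma pure_tensor0l m : pure_tensor (0 : A) m = 0.
Proof. exact/tensor_ofE/tcong_0l. Qed.

Lemma pure_tensorBl a a' m :
  pure_tensor (a - a') m = pure_tensor a m - pure_tensor a' m.
Proof. by apply: (addIr (pure_tensor a' m)); rewrite -pure_tensorDl !subrK. Qed.

Lemma pure_tensor0r a : pure_tensor a (0 : M) = 0.
Proof. by rewrite -(scale0r (0 : M)) pure_tensorZr scale0r. Qed.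

Lemma pure_tensor_suml (J : Type) (r : seq J) (P : pred J) (F : J -> A) m :
  pure_tensor (\sum_(i <- r | P i) F i) m =
  \sum_(i <- r | P i) pure_tensor (F i) m.
Proof.
apply: (big_morph (fun a => pure_tensor a m)) => [a b|].
  exact: pure_tensorDl.
exact: pure_tensor0l.
Qed.

Lemma pure_tensor_sumr (J : Type) (r : seq J) (P : pred J) (F : J -> M) a :
  pure_tensor a (\sum_(i <- r | P i) F i) =
  \sum_(i <- r | P i) pure_tensor a (F i).
Proof.
apply: (big_morph (fun m => pure_tensor a m)) => [m m'|].
  exact: pure_tensorDr.
exact: pure_tensor0r.
Qed.

Lemma tensor_indD (P : tensor A M -> Prop) :
  P 0 -> (forall a m x, P x -> P (pure_tensor a m + x)) -> forall x, P x.
Proof.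
move=> P0 PD; elim/tensor_of_ind; elim=> [|[a m] s IHs] //.
by rewrite -cat1s tensor_ofD; apply: PD.
Qed.

Lemma bilinear_factor (N : lmodType R) (b : A -> M -> N) :
  (forall a, linear (b a)) -> (forall m, linear (b^~ m)) ->
  exists g : {linear tensor A M -> N}, forall a m, g (pure_tensor a m) = b a m.
Proof.
by move=> br bl; have [g [gE _]] := tensor_universal br bl; exists g.
Qed.

End TensorTheory.

Section TensorMap.
Variables (R : comPzRingType) (A B M : lmodType R) (f : {linear A -> B}).

Lemma tensor_map0 : tensor_map f (0 : tensor A M) = 0.
Proof.
have e (C : lmodType R) : (0 : tensor C M) = tensor_of [::] by [].
by rewrite !e tensor_mapE.
Qed.

Lemma tensor_mapD (x y : tensor A M) :
  tensor_map f (x + y) = tensor_map f x + tensor_map f y.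
Proof.
elim/tensor_of_ind: x => s; elim/tensor_of_ind: y => t.
by rewrite -tensor_ofD !tensor_mapE map_cat tensor_ofD.
Qed.

Lemma tensor_mapZ (r : R) (x : tensor A M) :
  tensor_map f (r *: x) = r *: tensor_map f x.
Proof.
elim/tensor_indD: x => [|a m x IHx];
  first by rewrite tensor_map0 !scaler0 tensor_map0.
rewrite scalerDr !tensor_mapD IHx scalerDr; congr (_ + _).
rewrite -pure_tensorZr -!pure_tensorZ !tensor_map_pure linearZ.
by rewrite pure_tensorZ pure_tensorZr.
Qed.

End TensorMap.

(** * Semi-compactness of flat modules *)

Section FlatRegular.
Variables (R : comPzRingType) (M : lmodType R).
Hypothesis M_flat : flat M.

Lemma tensor_regular_inj (m : M) : pure_tensor (1 : R^o) m = 0 -> m = 0.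
Proof.
have [||g gE] := @bilinear_factor R (R^o : lmodType R) M M (fun a m => a *: m).
- by move=> a r u v; rewrite scalerDr !scalerA mulrC.
- by move=> u r a b; rewrite scalerDl scalerA.
by move=> m0; rewrite -[m]scale1r -(gE (1 : R^o)) m0 raddf0.
Qed.

(** Multiplication by s is an injection of R into itself; tensored with M it
    becomes multiplication by s on M. *)
Lemma flat_regular (s : R) (m : M) : GRing.lreg s -> s *: m = 0 -> m = 0.
Proof.
move=> s_reg sm0.
pose mul_s : {linear R^o -> R^o} := GRing.scale s.
apply: tensor_regular_inj; apply: (M_flat (f := mul_s)) => //.
rewrite tensor_map_pure tensor_map0.
by rewrite [mul_s 1](_ : _ = s *: (1 : R^o)) // pure_tensorZ sm0 pure_tensor0r.
Qed.

End FlatRegular.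

(** The ideal J consists of the elements that kill, for some finite set F of
    indices, everything killed by all the I_l with l in F.  It contains
    every I_l, and the element a that splits it comes with one such F.  A
    solution y for F is a global one: if z solves the congruences of F and of
    l, then a kills y - z, hence so does every element of J, because s acts
    injectively. *)
Lemma flat_semi_compact (R : comPzRingType) (M : lmodType R) :
  ideals_split R -> flat M -> semi_compact M.
Proof.
move=> split_R M_flat L I x I_id fin_sol.
pose killed (F : set L) (m : M) := forall l, F l -> annihilated_by (I l) m.
pose J : set R := [set a | exists2 F, finite_set F &
  forall m, killed F m -> a *: m = 0].
have J_id : ideal J.
  split; first by exists set0 => // m _; rewrite scale0r.
  move=> c a b [F Ffin Fa] [G Gfin Gb]; exists (F `|` G).
    by rewrite finite_setU.
  move=> m km; rewrite scalerDl -scalerA.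
  rewrite Fa ?Gb ?scaler0 ?addr0 // => l Fl; apply: km.
    by right.
  by left.
have [a [s [[F Ffin Fa] s_reg aE]]] := split_R J J_id.
have [y yF] := fin_sol F Ffin; exists y => l b Ilb.
have [|z zFl] := fin_sol (F `|` [set l]); first by rewrite finite_setU.
have Jb : J b.
  by exists [set l] => // m; apply.
have yz : b *: (y - z) = 0.
  apply: (flat_regular M_flat s_reg).
  rewrite scalerA mulrC aE // -scalerA Fa ?scaler0 // => k Fk c Ic.
  (* Both y and z solve the congruences with indices in F. *)
  have -> : y - z = (y - x k) - (z - x k) by rewrite opprB addrA subrK.
  by rewrite scalerBr (yF _ Fk) // (zFl k) ?subrr //; left.
have -> : y - x l = (y - z) + (z - x l) by rewrite addrA subrK.
by rewrite scalerDr yz add0r (zFl l) //; right.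
Qed.

(** * The equational criterion for flatness *)

Section KernelOfTensorMap.
Variables (R : comPzRingType) (V W M : lmodType R) (f : {linear V -> W}).

Definition from_kernel : set (tensor V M) :=
  [set x | exists2 l, x = tensor_of l & forall z, z \in l -> f z.1 = 0].

Lemma from_kernel_submod : submodule from_kernel.
Proof.
split=> [|a _ _ [l -> kl] [l' -> kl']]; first by exists [::].
exists (formal_scale a l ++ l'); first by rewrite tensor_ofD tensor_ofZ.
move=> z; rewrite mem_cat => /orP[/mapP[w /kl fw ->]|/kl' //].
by rewrite /= linearZ_LR fw scaler0.
Qed.

Lemma pure_from_kernel v m : f v = 0 -> from_kernel (pure_tensor v m).
Proof. by move=> fv; exists [:: (v, m)] => // z; rewrite inE => /eqP ->. Qed.

(** This is exactness of ker f (x) M -> V (x) M -> W (x) M.  Flatness,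
    applied to the inclusion of the image of f into W, says that the image of
    x in f(V) (x) M is already 0.  A set-theoretic section of V -> f(V)
    lifts formal sums from f(V) (x) M to V (x) M; it respects the tensor
    congruence up to tensors coming from the kernel, since the section is
    linear up to the kernel. *)
Lemma flat_tensor_map_kernel (x : tensor V M) :
  flat M -> tensor_map f x = 0 -> from_kernel x.
Proof.
move=> M_flat; elim/tensor_of_ind: x => s fs0.
pose N : set W := [set w | exists v, w = f v].
have N_sub : submodule N.
  split=> [|a _ _ [u ->] [v ->]]; first by exists 0; rewrite raddf0.
  by exists (a *: u + v); rewrite linearP.
have /choice[lift liftE] (a : submod_type N_sub) : exists v, \val a = f v.
  by have [v vE] := submod_typeP a; exists v.
have fliftE a : f (lift a) = \val a by rewrite liftE.
pose corestr v : submod_type N_sub :=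
  submod_elt N_sub (ex_intro _ v erefl : N (f v)).
have subK := from_kernel_submod.
have inK v m : f v = 0 -> from_kernel (pure_tensor v m) :=
  @pure_from_kernel v m.
pose F (t : seq (submod_type N_sub * M)) :=
  \sum_(z <- t) pure_tensor (lift z.1) z.2.
have F_cong t t' : tensor_cong t t' -> from_kernel (F t - F t').
  have F_cat u u' : F (u ++ u') = F u + F u' by rewrite /F big_cat.
  elim=> {t t'} [t|t t' _ ih|t t' u _ ih _ ih'|t t' u u' _ ih _ ih'|t t'|m|
    a a' m|a m m'|r a m].
  - by rewrite subrr; apply: (submod0 subK).
  - by rewrite -opprB; apply: (submodN subK).
  - by rewrite -[F t](subrK (F t')) -addrA; apply: (submodD subK).
  - by rewrite !F_cat opprD addrACA; apply: (submodD subK).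
  - by rewrite !F_cat (addrC (F t)) subrr; apply: (submod0 subK).
  - rewrite /F big_seq1 big_nil subr0 /=; apply: inK.
    by rewrite fliftE linear0.
  - rewrite /F !big_cons !big_nil !addr0 /= -pure_tensorDl -pure_tensorBl;
      apply: inK.
    by rewrite linearB linearD !fliftE linearD subrr.
  - by rewrite /F !big_cons !big_nil !addr0 /= pure_tensorDr subrr;
      apply: (submod0 subK).
  - rewrite /F !big_seq1 /= -pure_tensorZ -pure_tensorBl; apply: inK.
    by rewrite linearB linearZ_LR !fliftE linearZ_LR subrr.
pose s' := [seq (corestr z.1, z.2) | z <- s].
have s'0 : tensor_cong s' [::].
  pose incl : {linear submod_type N_sub -> W} := \val.
  have incl_inj : injective incl by move=> a b /val_inj.
  apply/tensor_ofE/(M_flat _ _ _ incl_inj).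
  rewrite [RHS]tensor_map0 tensor_mapE -map_comp.
  by rewrite tensor_mapE in fs0.
rewrite -[tensor_of s](subrK (F s')); apply: (submodD subK); last first.
  by rewrite -[F s']subr0 (_ : 0 = F [::]);
    [exact: F_cong | rewrite /F big_nil].
rewrite tensor_of_sum /F big_map -sumrB; apply: (submod_sum subK) => z _.
rewrite -pure_tensorBl; apply: inK.
by rewrite linearB fliftE subrr.
Qed.

End KernelOfTensorMap.

Section EquationalCriterion.
Variables (R : comPzRingType) (M : lmodType R).
Hypothesis M_flat : flat M.

(** Pair the basis vectors of R^n with the m i: the relation says that the
    resulting tensor is sent to 0 by the linear form k, so it comes from the
    kernel of that form, and the kernel vectors that occur are the columns of
    B. *)
Lemma flat_relation n (m : 'I_n -> M) (k : 'rV[R]_n) :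
  \sum_i k 0 i *: m i = 0 ->
  exists p (B : 'M[R]_(n, p)) (y : 'I_p -> M),
    (forall i, m i = \sum_j B i j *: y j) /\ k *m B = 0.
Proof.
move=> km0; pose f : {linear 'rV[R]_n -> 'M[R]_1} := mulmxr k^T.
pose s := [seq (delta_mx 0 i : 'rV[R]_n, m i) | i <- index_enum 'I_n].
have /(flat_tensor_map_kernel M_flat)[l sE kl] : tensor_map f (tensor_of s) = 0.
  rewrite tensor_mapE tensor_of_sum /s !big_map /=.
  under eq_bigr => i _.
    rewrite -rowE (_ : row i k^T = k 0 i *: 1%:M).
      by rewrite pure_tensorZ; over.
    by apply/rowP => j; rewrite !ord1 !mxE mulr1.
  by rewrite -pure_tensor_sumr km0 pure_tensor0r.
pose t := in_tuple l.
exists (size l), (\matrix_(i, j) (tnth t j).1 0 i), (fun j => (tnth t j).2);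
  split.
  move=> i.
  have [||g gE] := @bilinear_factor R 'rV[R]_n M M (fun u v => u 0 i *: v).
  - by move=> u a v w; rewrite scalerDr !scalerA mulrC.
  - by move=> v a u w; rewrite !mxE scalerDl scalerA.
  have := congr1 g sE; rewrite !tensor_of_sum !raddf_sum /s big_map /=.
  under eq_bigr => j _ do rewrite gE mxE eqxx /=.
  under [RHS]eq_bigr => z _ do rewrite gE.
  rewrite (bigD1 i) //= eqxx scale1r big1 ?addr0 => [->|j ji].
    rewrite (big_tnth _ _ l); apply: eq_bigr => j _; by rewrite mxE.
  by rewrite eq_sym (negPf ji) scale0r.
apply/rowP => j; rewrite !mxE.
have /rowP/(_ 0) := kl _ (mem_tnth j t).
rewrite !mxE => {2}<-; apply: eq_bigr => i _; by rewrite !mxE mulrC.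
Qed.

(** The relations are killed one after the other; each step replaces the
    current tuple by one that generates it. *)
Lemma flat_relations n (m : 'I_n -> M) (ks : seq 'rV[R]_n) :
  (forall k, k \in ks -> \sum_i k 0 i *: m i = 0) ->
  exists p (B : 'M[R]_(n, p)) (y : 'I_p -> M),
    (forall i, m i = \sum_j B i j *: y j) /\ (forall k, k \in ks -> k *m B = 0).
Proof.
move: {2}(size ks) (erefl (size ks)) => q.
elim: q n m ks => [|q IHq] n m [|k ks] // szks kms.
  exists n, 1%:M, m; split=> // i; rewrite (bigD1 i) //= mxE eqxx scale1r.
  by rewrite big1 ?addr0 // => j ji; rewrite mxE eq_sym (negPf ji) scale0r.
have [p [B [y [mE kB]]]] := flat_relation (kms _ (mem_head _ _)).
have [||r [C [z [yE ksC]]]] := IHq _ y (map (mulmx^~ B) ks).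
  by rewrite size_map; case: szks.
  move=> _ /mapP[h hks ->].
  rewrite -[RHS](kms h); last by rewrite inE hks orbT.
  under eq_bigr => j _ do rewrite mxE scaler_suml.
  rewrite exchange_big /=; apply: eq_bigr => i _; rewrite mE scaler_sumr.
  by apply: eq_bigr => j _; rewrite scalerA.
exists r, (B *m C), z; split=> [i|h].
  rewrite mE; under eq_bigr => j _ do rewrite yE scaler_sumr.
  rewrite exchange_big /=; apply: eq_bigr => j _; rewrite mxE scaler_suml.
  by apply: eq_bigr => i' _; rewrite scalerA.
rewrite inE mulmxA => /orP[/eqP -> | hks]; first by rewrite kB mul0mx.
by apply: ksC; apply: map_f.
Qed.

End EquationalCriterion.

(** * Finite projectivity of flat modules *)

Section SplitNoetherian.
Variable R : comPzRingType.
Hypothesis split_R : ideals_split R.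

(** A form of noetherianity: after inverting the regular elements, the list
    ks generates K, and as regular elements act injectively on the entries of
    a matrix, k *m B only needs to vanish on ks.  The vectors of K whose
    first j coordinates vanish are treated by descending j: the ideal of
    their coordinates of index j splits, and one vector realizing its element
    a suffices to clear that coordinate, up to a regular factor. *)
Lemma split_submodule_generators n (K : set 'rV[R]_n) : submodule K ->
  exists2 ks : seq 'rV[R]_n, (forall k, k \in ks -> K k) &
    forall p (B : 'M[R]_(n, p)), (forall k, k \in ks -> k *m B = 0) ->
      forall k, K k -> k *m B = 0.
Proof.
move=> K_sub.
pose Kj j : set 'rV[R]_n :=
  [set k | K k /\ forall i : 'I_n, (i < j)%N -> k 0 i = 0].
suff gen d : exists2 ks : seq 'rV[R]_n, (forall k, k \in ks -> K k) &
    forall p (B : 'M[R]_(n, p)), (forall k, k \in ks -> k *m B = 0) ->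
      forall k, Kj (n - d)%N k -> k *m B = 0.
  have [ks Kks ksB] := gen n; exists ks => // p B ksB0 k Kk.
  by apply: (ksB _ _ ksB0); rewrite subnn; split.
elim: d => [|d [ks Kks ksB]].
  exists [::] => // p B _ k; rewrite subn0 => -[_ k0].
  by rewrite (_ : k = 0) ?mul0mx //; apply/rowP => i; rewrite mxE k0.
case: (leqP n d) => [nd|dn].
  exists ks => // p B /ksB.
  by move: nd (leqW nd); rewrite -!subn_eq0 => /eqP -> /eqP ->.
have jn : (n - d.+1 < n)%N by rewrite ltn_subrL; case: (n) dn.
have jE : (n - d = (n - d.+1).+1)%N by rewrite subnSK.
pose j := Ordinal jn.
pose I : set R := [set r | exists2 k, Kj (n - d.+1)%N k & r = k 0 j].
have I_id : ideal I.
  split.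
    exists 0; last by rewrite mxE.
    by split=> [|i _]; [exact: (submod0 K_sub) | rewrite mxE].
  move=> a _ _ [k [Kk k0] ->] [h [Kh h0] ->]; exists (a *: k + h).
    split; first exact: (submodZD K_sub).
    by move=> i ij; rewrite !mxE k0 // h0 // mulr0 addr0.
  by rewrite !mxE.
have [_ [s [[k0 [Kk0 k00] ->] s_reg sE]]] := split_R I_id.
exists (k0 :: ks) => [k|p B ksB0 k [Kk kj]].
  by rewrite inE => /orP[/eqP ->|/Kks].
have skB : (s *: k - k 0 j *: k0) *m B = 0.
  apply: ksB => [h hks|]; first by apply: ksB0; rewrite inE hks orbT.
  split.
    by apply: (submodB K_sub); apply: (submodZ K_sub).
  move=> i; rewrite jE ltnS leq_eqVlt !mxE => /orP[/eqP/(@ord_inj _ _ j) ->|ij].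
    rewrite mulrC sE ?subrr //; by exists k.
  by rewrite (kj i) // (k00 i) // !mulr0 subr0.
(* The coordinate of index j has been cleared, at the cost of the factor s. *)
have {}skB : s *: (k *m B) = 0.
  move: skB; rewrite mulmxBl -!scalemxAl (ksB0 k0) ?mem_head //.
  by rewrite scaler0 subr0.
apply/matrixP => i i'; rewrite [RHS]mxE; apply: (lreg_eq0 s_reg).
by move/matrixP/(_ i i'): skB; rewrite mxE [RHS]mxE.
Qed.

Lemma free_rV n : @free_module R 'rV[R]_n.
Proof.
exists 'I_n, (fun i => delta_mx 0 i); split.
  move=> s c us /rowP s0 i si; have := s0 i; rewrite summxE mxE.
  rewrite (bigD1_seq i) //= !mxE !eqxx mulr1 big1 ?addr0 // => j ji.
  by rewrite !mxE eq_sym (negPf ji) andbF mulr0.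
move=> x; exists (index_enum 'I_n), (fun i => x 0 i); exact: row_sum_delta.
Qed.

(** Let f map the generators g i to m i, and let K be the module of relations
    between the g i.  Killing finitely many relations of the m i, which
    flatness allows, kills all of K, so the factorization of R^n -> M through
    R^p descends to N. *)
Lemma flat_finitely_projective (M : lmodType R) :
  flat M -> finitely_projective M.
Proof.
move=> M_flat N [n [g gen]] f.
pose K : set 'rV[R]_n := [set k | \sum_i k 0 i *: g i = 0].
have K_sub : submodule K.
  split=> [|a u v /= u0 v0].
    by rewrite /K /= big1 // => i _; rewrite mxE scale0r.
  rewrite /K /=; under eq_bigr => i _ do rewrite !mxE scalerDl -scalerA.
  by rewrite big_split /= -scaler_sumr u0 v0 scaler0 addr0.
have [ks Kks ksB] := split_submodule_generators K_sub.
have [|p [B [y [mE kB]]]] := @flat_relations R M M_flat n (f \o g) ks.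
  move=> k /Kks Kk; rewrite -[RHS](raddf0 f) -[in RHS]Kk raddf_sum.
  by apply: eq_bigr => i _; rewrite /= linearZ_LR.
have {ksB}KB := ksB _ _ kB.
have /choice[c cE] (x : N) : exists k : 'rV[R]_n, x = \sum_i k 0 i *: g i.
  have [k ->] := gen x; exists (\row_i k i).
  by apply: eq_bigr => i _; rewrite mxE.
have u_lin : linear (fun x => c x *m B).
  move=> a x x'; apply/eqP; rewrite -subr_eq0 scalemxAl -mulmxDl -mulmxBl;
    apply/eqP/KB.
  rewrite /K /=; under eq_bigr => i _ do
    rewrite !mxE scalerBl scalerDl -scalerA.
  by rewrite sumrB big_split /= -scaler_sumr -!cE subrr.
have v_lin : linear (fun b : 'rV[R]_p => \sum_j b 0 j *: y j).
  move=> a b b'; under eq_bigr => i _ do rewrite !mxE scalerDl -scalerA.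
  by rewrite big_split /= -scaler_sumr.
pose u : {linear N -> 'rV[R]_p} :=
  HB.pack (fun x => c x *m B) (GRing.isLinear.Build R N _ _ _ u_lin).
pose v : {linear 'rV[R]_p -> M} :=
  HB.pack (fun b : 'rV[R]_p => \sum_j b 0 j *: y j)
    (GRing.isLinear.Build R _ M _ _ v_lin).
exists 'rV[R]_p, u, v; split; first exact: free_rV.
move=> x /=; rewrite {1}[x]cE raddf_sum /=.
under [RHS]eq_bigr => j _ do rewrite mxE scaler_suml.
rewrite exchange_big /=; apply: eq_bigr => i _.
rewrite linearZ_LR [f (g i)]mE scaler_sumr;
by apply: eq_bigr => j _; rewrite scalerA.
Qed.

End SplitNoetherian.

(** * Orthogonal sequences *)

Lemma reduced_sqr0 (R : comPzRingType) (x : R) :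
  reduced R -> x * x = 0 -> x = 0.
Proof. by move=> R_red xx; apply: (R_red x 2). Qed.

Definition orthogonal_sequence (R : comPzRingType) (d : nat -> R) :=
  (forall n, d n != 0) /\ (forall i j, i != j -> d i * d j = 0).

Section OrthogonalSequences.
Variable R : comPzRingType.
Hypothesis R_reduced : reduced R.

(** If J, the sum of I and of its annihilator, contains a regular element a +
    c, then a and a + c split I.  Since R is reduced, no nonzero element
    kills J; so as long as a partial sum s of the sequence, which lies in J,
    is a zero divisor, some nonzero element of J kills s, and it can be
    appended to the sequence. *)
Lemma no_orthogonal_sequence_split :
  (forall d : nat -> R, ~ orthogonal_sequence d) -> ideals_split R.
Proof.
move=> no_orth I I_id; apply: contrapT => nsplit.
pose J : set R := [set x | exists a c,
  [/\ I a, forall b, I b -> b * c = 0 & x = a + c]].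
have IJ a : I a -> J a.
  by move=> Ia; exists a, 0; split; rewrite ?addr0 // => b _; rewrite mulr0.
have JD x y : J x -> J y -> J (x + y).
  move=> [a [c [Ia cI ->]]] [a' [c' [Ia' cI' ->]]]; exists (a + a'), (c + c');
    split.
  - exact: (submodD I_id).
  - by move=> b Ib; rewrite mulrDr cI // cI' // addr0.
  - by rewrite addrACA.
have JM z x : J x -> J (z * x).
  move=> [a [c [Ia cI ->]]]; exists (z * a), (z * c); split.
  - exact: idealM.
  - by move=> b Ib; rewrite mulrCA cI // mulr0.
  - by rewrite mulrDr.
have J_dense z : (forall x, J x -> z * x = 0) -> z = 0.
  move=> zJ; apply: reduced_sqr0 => //; apply: (zJ z); exists 0, z; split.
  - exact: (submod0 I_id).
  - by move=> b /IJ Jb; rewrite mulrC zJ.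
  - by rewrite add0r.
have /choice[next nextP] s : exists d, J s -> [/\ J d, d != 0 & d * s = 0].
  case: (pselect (J s)) => [Js|nJs]; last by exists 0.
  have /lregPn[z z0 sz] : ~ GRing.lreg s.
    move: (Js) => [a [c [Ia cI sE]]] s_reg; apply: nsplit; exists a, s;
      split => // b Ib.
    by rewrite sE mulrDr cI // addr0.
  have [x Jx zx] : exists2 x, J x & z * x != 0.
    apply: contrapT => nx; move/eqP: z0; apply; apply: J_dense => x Jx.
    by apply: contrapT => /eqP zx; apply: nx; exists x.
  exists (z * x) => _; split=> //; first exact: JM.
  by rewrite mulrAC (mulrC z) sz mul0r.
(* The partial sums of the sequence d constructed below. *)
pose fix s n := if n is n'.+1 then s n' + next (s n') else 0.
have Js n : J (s n).
  elim: n => [|n Js] /=; first exact/IJ/(submod0 I_id).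
  by apply: JD => //; have [] := nextP _ Js.
pose d n := next (s n).
have ds n : d n * s n = 0 by have [] := nextP _ (Js n).
(* Orthogonality passes from n to n + 1 as s_n d_i keeps the value d_i^2. *)
have orth i n : (i < n)%N -> s n * d i = d i * d i /\ d n * d i = 0.
  elim: n => // n IHn; rewrite ltnS => i_le_n.
  have sd : s n.+1 * d i = d i * d i.
    rewrite /= mulrDl -/(d n); move: i_le_n;
      rewrite leq_eqVlt => /orP[/eqP->|/IHn[-> ->]].
      by rewrite mulrC ds add0r.
    by rewrite addr0.
  split=> //; apply: reduced_sqr0 => //.
  by rewrite mulrACA -sd mulrACA ds mul0r.
apply: (no_orth d); split=> [n|i j]; first by have [] := nextP _ (Js n).
by rewrite neq_ltn => /orP[/orth[_]|/orth[_ ->//]]; rewrite mulrC.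
Qed.

End OrthogonalSequences.

(** * The free module of countable rank *)

Section FlatCoordinates.
Variables (R : comPzRingType) (M : lmodType R).
Variables (coord : nat -> {linear M -> R^o}) (e : nat -> M).
Hypothesis coordE : forall m, exists N, forall n, (N <= n)%N ->
  m = \sum_(k < n) coord k m *: e k.

Lemma tensor_coordinates (A : lmodType R) (k : nat) :
  exists g : {linear tensor A M -> A},
    forall a m, g (pure_tensor a m) = coord k m *: a.
Proof.
apply: bilinear_factor => [a r u v|m r a b].
  by rewrite linearP scalerDl scalerA.
by rewrite scalerDr !scalerA mulrC.
Qed.

(** Only finitely many elements of M occur in x, so one bound N serves for
    all of them. *)
Lemma tensor_coordinatesE (A : lmodType R) (g : nat -> tensor A M -> A) :
  (forall k, linear (g k)) ->
  (forall k a m, g k (pure_tensor a m) = coord k m *: a) ->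
  forall x, exists N, forall n, (N <= n)%N ->
    x = \sum_(k < n) pure_tensor (g k x) (e k).
Proof.
move=> glin gE; elim/tensor_indD => [|a m x [N xE]].
  exists 0%N => n _; rewrite big1 // => k _.
  have := glin k 1 0 0; rewrite !scale1r !addr0 => /eqP.
  by rewrite -subr_eq0 opprD addrA subrr sub0r oppr_eq0 => /eqP ->;
    rewrite pure_tensor0l.
have [N' mE] := coordE m; exists (maxn N N') => n;
  rewrite geq_max => /andP[/xE {1}-> /mE {1}->].
rewrite pure_tensor_sumr -big_split /=; apply: eq_bigr => k _.
rewrite -[X in g k (X + _)]scale1r glin scale1r gE pure_tensorDl.
by rewrite pure_tensorZ.
Qed.

(** The coordinates on A (x) M are natural in A and determine a tensor, so
    they reflect the injectivity of f. *)
Lemma flat_coordinates : flat M.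
Proof.
move=> A B f f_inj x y fxy.
have /choice[gA gAE] := tensor_coordinates A.
have /choice[gB gBE] := tensor_coordinates B.
have natural k z : gB k (tensor_map f z) = f (gA k z).
  elim/tensor_indD: z => [|a m z IHz]; first by rewrite tensor_map0 !raddf0.
  by rewrite tensor_mapD !raddfD /= IHz tensor_map_pure gAE gBE linearZ_LR.
have gAxy k : gA k x = gA k y by apply: f_inj; rewrite -!natural fxy.
have dec := @tensor_coordinatesE A gA (fun k => linearP (gA k)) gAE.
have [N xE] := dec x; have [N' yE] := dec y.
rewrite (xE (maxn N N')) ?leq_maxl // (yE (maxn N N')) ?leq_maxr //.
by apply: eq_bigr => k _; rewrite gAxy.
Qed.

End FlatCoordinates.

Section FiniteSupport.
Variable R : comPzRingType.

Definition finite_support : set (nat -> R^o) :=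
  [set u | exists N, forall i, (N <= i)%N -> u i = 0].

Lemma finite_support_submod : submodule finite_support.
Proof.
split=> [|a u v [N uN] [N' vN']]; first by exists 0%N.
exists (maxn N N') => i; rewrite geq_max => /andP[/uN + /vN'].
by rewrite /= => ui vi; rewrite !fctE ui vi scaler0 addr0.
Qed.

Definition finsupp_module := submod_type finite_support_submod.

Fact unit_vector_finite (k : nat) : finite_support (fun i => (i == k)%:R).
Proof. by exists k.+1 => i ki; rewrite gtn_eqF. Qed.

Definition unit_vector (k : nat) : finsupp_module :=
  submod_elt finite_support_submod (unit_vector_finite k).

Definition finsupp_coord (k : nat) (u : finsupp_module) : R^o := \val u k.

Fact finsupp_coord_linear k : linear (finsupp_coord k).
Proof. by []. Qed.
HB.instance Definition _ k :=
  GRing.isLinear.Build R finsupp_module R^o _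
    (finsupp_coord k) (finsupp_coord_linear k).

Lemma finsupp_coord_ext (u v : finsupp_module) :
  (forall k, finsupp_coord k u = finsupp_coord k v) -> u = v.
Proof. by move=> uv; apply/val_inj/funext. Qed.

Lemma finsupp_coord_unit i k : finsupp_coord i (unit_vector k) = (i == k)%:R.
Proof. by []. Qed.

Lemma finsupp_flat : flat finsupp_module.
Proof.
apply: (@flat_coordinates R _ finsupp_coord unit_vector) => u.
have [N uN] := submod_typeP u; exists N => n Nn.
apply: finsupp_coord_ext => i; rewrite raddf_sum /=.
under eq_bigr => k _ do rewrite linearZ_LR /= finsupp_coord_unit.
case: (ltnP i n) => [i_n|n_i].
  rewrite (bigD1 (Ordinal i_n)) //= eqxx [X in X + _]mulr1 big1 ?addr0 // => k.
  by rewrite -val_eqE /= eq_sym => /negPf ->; apply: mulr0.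
rewrite /finsupp_coord uN ?(leq_trans Nn) // big1 // => k _.
by rewrite gtn_eqF ?(leq_trans (ltn_ord k)) //; apply: mulr0.
Qed.

(** The congruences y = d_l e_l modulo the elements killed by d_l are solved,
    over a finite set of indices, by the sum of the right-hand sides.  A
    global solution y would satisfy d_l y_l = d_l^2 for all l, which is
    nonzero as R is reduced. *)
Lemma semi_compact_no_orthogonal (d : nat -> R) : reduced R ->
  semi_compact finsupp_module -> ~ orthogonal_sequence d.
Proof.
move=> R_red sc [d0 d_orth].
pose I (l : nat) : set R := [set r | exists c, r = c * d l].
pose x (l : nat) := d l *: unit_vector l.
have kill i l : l != i -> d l *: x i = 0.
  by move=> li; rewrite scalerA d_orth ?scale0r.
have [l|F Ffin|y yx] := sc nat I x.
- split=> [|a _ _ [c ->] [c' ->]]; first by exists 0; rewrite mul0r.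
  by exists (a * c + c'); rewrite mulrDl -mulrA.
- have /finite_seqP[s FE] := Ffin.
  exists (\sum_(i <- undup s) x i) => l; rewrite FE /= => ls _ [c ->].
  rewrite (bigD1_seq l) ?undup_uniq ?mem_undup //= addrAC subrr add0r.
  rewrite -scalerA scaler_sumr big1 ?scaler0 // => i il.
  by apply: kill; rewrite eq_sym.
have [N yN] := submod_typeP y.
have Id : I N (d N) by exists 1; rewrite mul1r.
have yxN : d N *: (y - d N *: unit_vector N) = 0 := yx N _ Id.
have /eqP := congr1 (finsupp_coord N) yxN.
rewrite [finsupp_coord N _](_ : _ = d N * (\val y N - d N * (N == N)%:R)) //.
rewrite yN // eqxx mulr1 sub0r mulrN [finsupp_coord N 0](_ : _ = 0) //.
rewrite oppr_eq0 => /eqP /(reduced_sqr0 R_red) dN.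
by move: (d0 N); rewrite dN eqxx.
Qed.

End FiniteSupport.

(** * Localization of modules *)

Section Localization.
Variables (R : comPzRingType) (S : set R).
Hypotheses (S1 : S 1) (SM : forall s t, S s -> S t -> S (s * t)).

Definition denominator := {s : R | `[< S s >]}.
Implicit Types s t u : denominator.

(** Kept from reducing so that simplification does not change the form in
    which denominators appear. *)
Definition dval s : R := val s.
Arguments dval : simpl never.

Lemma denominatorP s : S (dval s). Proof. exact/asboolP/(valP s). Qed.
Definition denom (s : R) (Ss : S s) : denominator := Sub s (asboolT Ss).
Definition denomM s t : denominator :=
  denom (SM (denominatorP s) (denominatorP t)).

Lemma dval1 : dval (denom S1) = 1. Proof. by []. Qed.
Lemma dvalM s t : dval (denomM s t) = dval s * dval t. Proof. by []. Qed.
Definition dvalE := (dval1, dvalM).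

Section LocalizedModule.
Variable V : lmodType R.
Implicit Types v w : V.

(** The extra factor u makes the relation transitive although the
    denominators may be zero divisors. *)
Definition loc_eq (x y : V * denominator) : bool :=
  `[< exists2 u : R, S u & (u * dval y.2) *: x.1 = (u * dval x.2) *: y.1 >].

Lemma loc_eq_equiv : equiv_class_of loc_eq.
Proof.
split=> [x|x y|y x z].
- by apply/asboolP; exists 1.
- by apply/asboolP/asboolP => -[u Su e]; exists u.
- move=> /asboolP[u Su xy] /asboolP[w Sw yz]; apply/asboolP.
  exists (u * w * dval y.2).
    by apply: SM; [exact: SM | exact: denominatorP].
  have -> : u * w * dval y.2 * dval z.2 =
      (w * dval z.2) * (u * dval y.2) by ring.
  rewrite -scalerA xy scalerA.
  have -> : w * dval z.2 * (u * dval x.2) =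
      (u * dval x.2) * (w * dval z.2) by rewrite mulrC.
  rewrite -scalerA yz scalerA; congr (_ *: _); ring.
Qed.

Canonical loc_eq_rel := EquivRelPack loc_eq_equiv.

Definition localization := {eq_quot loc_eq_rel}.
HB.instance Definition _ := Choice.on localization.

Definition lfrac v s : localization := \pi_localization (v, s).

Lemma lfracE v w s t : lfrac v s = lfrac w t <->
  exists2 u : R, S u & (u * dval t) *: v = (u * dval s) *: w.
Proof. by split=> [/eqmodP/asboolP|e] //; apply/eqmodP/asboolP. Qed.

Lemma lfrac_ind (P : localization -> Prop) :
  (forall v s, P (lfrac v s)) -> forall x, P x.
Proof. by move=> h x; rewrite -[x]reprK; case: (repr x). Qed.

Lemma repr_lfrac v s :
  lfrac (repr (lfrac v s)).1 (repr (lfrac v s)).2 = lfrac v s.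
Proof. by rewrite -[RHS]reprK /lfrac; case: (repr _). Qed.

Definition lfrac_add (x y : localization) : localization :=
  let: (v, s) := repr x in let: (w, t) := repr y in
  lfrac (dval t *: v + dval s *: w) (denomM s t).
Definition lfrac_scale (r : R) (x : localization) : localization :=
  let: (v, s) := repr x in lfrac (r *: v) s.

Lemma lfrac_addE v s w t :
  lfrac_add (lfrac v s) (lfrac w t) =
  lfrac (dval t *: v + dval s *: w) (denomM s t).
Proof.
rewrite /lfrac_add; move: (repr_lfrac v s) (repr_lfrac w t).
case: (repr _) => v' s'; case: (repr _) => w' t' /=.
move=> /lfracE[a Sa ea] /lfracE[b Sb eb].
apply/lfracE; exists (a * b) => /=; first exact: SM.
rewrite !dvalE !scalerDr !scalerA; congr (_ + _).
  have -> : a * b * (dval s * dval t) * dval t' =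
      (b * dval t * dval t') * (a * dval s) by ring.
  rewrite -scalerA ea scalerA; congr (_ *: _); ring.
have -> : a * b * (dval s * dval t) * dval s' =
    (a * dval s * dval s') * (b * dval t) by ring.
rewrite -scalerA eb scalerA; congr (_ *: _); ring.
Qed.

Lemma lfrac_scaleE r v s : lfrac_scale r (lfrac v s) = lfrac (r *: v) s.
Proof.
rewrite /lfrac_scale; move: (repr_lfrac v s).
case: (repr _) => v' s' /= /lfracE[a Sa ea]; apply/lfracE; exists a => //.
by rewrite scalerA (mulrC _ r) -[LHS]scalerA ea !scalerA (mulrC r).
Qed.

Fact lfrac_addA : associative lfrac_add.
Proof.
elim/lfrac_ind=> v s; elim/lfrac_ind=> w t; elim/lfrac_ind=> x u.
rewrite !lfrac_addE; apply/lfracE; exists 1 => //=;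
  rewrite !dvalE !mul1r !scalerDr !scalerA.
rewrite addrA; congr (_ *: _ + _ *: _ + _ *: _); ring.
Qed.

Fact lfrac_addC : commutative lfrac_add.
Proof.
elim/lfrac_ind=> v s; elim/lfrac_ind=> w t; rewrite !lfrac_addE.
apply/lfracE; exists 1 => //=.
by rewrite !dvalE addrC (mulrC (dval s)).
Qed.

Fact lfrac_add0 : left_id (lfrac 0 (denom S1)) lfrac_add.
Proof.
elim/lfrac_ind=> v s; rewrite lfrac_addE; apply/lfracE; exists 1 => //=.
by rewrite !dvalE scaler0 add0r scale1r !mul1r.
Qed.

Fact lfrac_addN :
  left_inverse (lfrac 0 (denom S1)) (lfrac_scale (-1)) lfrac_add.
Proof.
elim/lfrac_ind=> v s; rewrite lfrac_scaleE lfrac_addE; apply/lfracE;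
  exists 1 => //=.
by rewrite scaleN1r scalerN addNr !scaler0.
Qed.

HB.instance Definition _ :=
  GRing.isZmodule.Build localization lfrac_addA lfrac_addC lfrac_add0
    lfrac_addN.

Lemma lfracD v s w t :
  lfrac v s + lfrac w t = lfrac (dval t *: v + dval s *: w) (denomM s t).
Proof. exact: lfrac_addE. Qed.

Lemma lfrac_eq0 v s : lfrac v s = 0 <-> exists2 u, S u & u *: v = 0.
Proof.
split=> [/lfracE[u Su]|[u Su uv]].
  by rewrite /= dval1 mulr1 scaler0; exists u.
by apply/lfracE; exists u; rewrite //= dval1 mulr1 scaler0.
Qed.

Lemma lfrac_mulK v s t : lfrac (dval t *: v) (denomM s t) = lfrac v s.
Proof.
by apply/lfracE; exists 1; rewrite //= dvalM !mul1r scalerA.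
Qed.

Lemma lfracDl v w s : lfrac (v + w) s = lfrac v s + lfrac w s.
Proof. by rewrite lfracD -scalerDr lfrac_mulK. Qed.

Fact lfrac_scaleA a b x :
  lfrac_scale a (lfrac_scale b x) = lfrac_scale (a * b) x.
Proof. by elim/lfrac_ind: x => v s; rewrite !lfrac_scaleE scalerA. Qed.

Fact lfrac_scale1 : left_id 1 lfrac_scale.
Proof. by elim/lfrac_ind=> v s; rewrite lfrac_scaleE scale1r. Qed.

Fact lfrac_scaleDr : right_distributive lfrac_scale +%R.
Proof.
move=> a; elim/lfrac_ind=> v s; elim/lfrac_ind=> w t.
rewrite lfracD !lfrac_scaleE lfracD; congr lfrac.
by rewrite scalerDr !scalerA !(mulrC a).
Qed.

Fact lfrac_scaleDl x : {morph lfrac_scale^~ x : a b / a + b}.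
Proof.
by move=> a b; elim/lfrac_ind: x => v s; rewrite !lfrac_scaleE scalerDl lfracDl.
Qed.

HB.instance Definition _ := GRing.Zmodule_isLmodule.Build R localization
  lfrac_scaleA lfrac_scale1 lfrac_scaleDr lfrac_scaleDl.

Lemma lfracZ r v s : r *: lfrac v s = lfrac (r *: v) s.
Proof. exact: lfrac_scaleE. Qed.

End LocalizedModule.
End Localization.

(** * Flatness of localizations *)

Section LocalizationFlat.
Variables (R : comPzRingType) (S : set R).
Hypotheses (S1 : S 1) (SM : forall s t, S s -> S t -> S (s * t)).
Local Notation loc V := (localization S1 SM V).
Local Notation locR := (loc (R^o : lmodType R)).
Local Notation rfrac r s := (@lfrac R S S1 SM (R^o : lmodType R) r s).

(** The natural map from the tensor product with S^-1 R to S^-1 V; it serves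
    to detect when a pure tensor is 0. *)
Lemma loc_tensor (V : lmodType R) :
  exists g : {linear tensor V locR -> loc V},
    forall v r s, g (pure_tensor v (rfrac r s)) = lfrac S1 SM (r *: v) s.
Proof.
pose b (v : V) (x : locR) := lfrac S1 SM ((repr x).1 *: v) (repr x).2.
have bE v r s : b v (rfrac r s) = lfrac S1 SM (r *: v) s.
  have /lfracE[u Su e] := repr_lfrac S1 SM (r : R^o) s.
  apply/lfracE; exists u => //; rewrite !scalerA.
  by congr (_ *: _).
have [||g gE] := @bilinear_factor R V locR (loc V) b.
- move=> v a; elim/lfrac_ind=> x s; elim/lfrac_ind=> y t.
  rewrite lfracZ lfracD !bE lfracZ lfracD; congr lfrac.
  rewrite scalerDl; congr (_ + _); rewrite !scalerA; congr (_ *: _).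
- move=> x a v w; elim/lfrac_ind: x => r s;
    rewrite !bE lfracZ -lfracDl scalerDr.
  by rewrite !scalerA (mulrC r).
by exists g => v r s; rewrite gE bE.
Qed.

(** Reduction to a common denominator. *)
Lemma loc_tensor_pure (V : lmodType R) (x : tensor V locR) :
  exists v s, x = pure_tensor v (rfrac 1 s).
Proof.
have fracE (r : R) s t : rfrac r s = (r * dval t) *: rfrac 1 (denomM SM s t).
  rewrite lfracZ -(lfrac_mulK _ _ _ _ t); congr lfrac.
  by rewrite [RHS]mulr1 mulrC.
elim/tensor_indD: x => [|v x y [w [t ->]]].
  by exists 0, (denom S1); rewrite pure_tensor0l.
elim/lfrac_ind: x => r s.
rewrite (fracE r s t) (fracE 1 t s) -!pure_tensorZ.
have -> : denomM SM t s = denomM SM s t by apply: val_inj; apply: mulrC.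
by rewrite -pure_tensorDl; eexists; eexists.
Qed.

(** Every tensor is of the form a (x) 1/s, and it is 0 if and only if some
    element of S kills a; as f is injective, an element that kills f a kills
    a. *)
Lemma localization_flat : flat locR.
Proof.
move=> A B f f_inj x y fxy; apply/eqP; rewrite -subr_eq0; apply/eqP.
have : tensor_map f (x - y) = 0.
  by rewrite -scaleN1r tensor_mapD tensor_mapZ fxy scaleN1r subrr.
have [a [s ->]] := loc_tensor_pure (x - y).
rewrite tensor_map_pure => fa0.
have [g gE] := loc_tensor B.
have /(congr1 g) := fa0; rewrite gE raddf0 scale1r => /lfrac_eq0[u Su ufa].
(* Here 1 / s = u / (s u), and the factor u can be moved over to a. *)
have ua : u *: a = 0 by apply: f_inj; rewrite raddf0 linearZ_LR.
have -> : rfrac 1 s = u *: rfrac 1 (denomM SM s (denom Su)).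
  rewrite lfracZ -(lfrac_mulK _ _ _ _ (denom Su)); congr lfrac.
by rewrite -pure_tensorZ ua pure_tensor0l.
Qed.

End LocalizationFlat.

(** * Singly projective modules *)

Section SinglyProjective.
Variables (R : comPzRingType) (M : lmodType R).

(** The list that writes x on the basis may repeat indices; repetitions are
    collected before independence of the basis is applied. *)
Lemma basis_coefficients (F : lmodType R) (x : F) : free_module F ->
  exists l : seq (R * F), x = \sum_(z <- l) z.1 *: z.2 /\
    forall a : R, a *: x = 0 -> forall z, z \in l -> a * z.1 = 0.
Proof.
move=> [I [b [b_free b_gen]]]; have [s [c xE]] := b_gen x.
pose c' i := (count_mem i s)%:R * c i.
have xE' : x = \sum_(i <- undup s) c' i *: b i.
  rewrite xE -big_undup_iterop_count; apply: eq_bigr => i _.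
  by rewrite /c' -scalerA scaler_nat.
exists [seq (c' i, b i) | i <- undup s]; rewrite big_map; split => // a.
rewrite {1}xE' scaler_sumr => ax _ /mapP[i si ->] /=.
apply: (b_free (undup s) (fun i => a * c' i)) => //; first exact: undup_uniq.
by rewrite -[RHS]ax; apply: eq_bigr => j _; rewrite scalerA.
Qed.

Lemma singly_projective_coefficients (m : M) : singly_projective M ->
  exists l : seq (R * M), m = \sum_(z <- l) z.1 *: z.2 /\
    forall a : R, a *: m = 0 -> forall z, z \in l -> a * z.1 = 0.
Proof.
move=> sp; pose N : set M := [set x | exists r, x = r *: m].
have N_sub : submodule N.
  split=> [|a _ _ [r ->] [r' ->]]; first by exists 0; rewrite scale0r.
  by exists (a * r + r'); rewrite scalerDl scalerA.
have Nm : N m by exists 1; rewrite scale1r.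
pose m0 := submod_elt N_sub Nm.
have [|F [g [h [F_free gh]]]] := sp (submod_type N_sub) _ \val.
  by exists m0 => x; have [r xE] := submod_typeP x; exists r; apply: val_inj.
have [l [gE lE]] := basis_coefficients (g m0) F_free.
exists [seq (z.1, h z.2) | z <- l]; split.
  rewrite [LHS](gh m0) /= gE raddf_sum big_map; apply: eq_bigr => z _ /=.
  by rewrite linearZ_LR.
move=> a am _ /mapP[z zl ->] /=; apply: lE => //.
rewrite -linearZ_LR (_ : a *: m0 = 0) ?raddf0 //; exact: val_inj.
Qed.

End SinglyProjective.

(** * Minimal primes of a reduced ring *)

Section MinimalPrimes.
Variable R : comPzRingType.
Hypothesis R_reduced : reduced R.

(** If a lies outside a maximal S, the products s a^n form a larger
    multiplicative set, which therefore contains 0; and s a^n = 0 gives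
    (sa)^(n+1) = 0, that is s a = 0 since R is reduced. *)
Lemma maximal_multiplicative (S0 : set R) :
  S0 1 -> (forall s t, S0 s -> S0 t -> S0 (s * t)) -> ~ S0 0 ->
  exists S : set R, [/\ S0 `<=` S, forall s t, S s -> S t -> S (s * t), ~ S 0 &
    forall a, ~ S a -> exists2 s, S s & s * a = 0].
Proof.
move=> S01 S0M S00.
(* Adding S0 to each set makes the empty union good too. *)
pose good (A : set R) :=
  (forall s t, (A `|` S0) s -> (A `|` S0) t -> (A `|` S0) (s * t))
  /\ ~ (A `|` S0) 0.
have [|A [[AM A0] A_max]] := @Zorn_bigcup R good.
  move=> C C_good C_total; split=> [s t|[[A CA A0]|//]]; last first.
    by case: (C_good _ CA) => _; apply; left.
  move=> [[A CA As]|S0s] [[B CB Bt]|S0t]; last by right; apply: S0M.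
  - have [D CD [Ds Dt]] : exists2 D, C D & D s /\ D t.
      by case: (C_total _ _ CA CB) => AB; [exists B|exists A] => //;
        split=> //; apply: AB.
    have [M _] := C_good _ CD.
    by case: (M s t (or_introl Ds) (or_introl Dt)) => ?; [left; exists D|right].
  - have [M _] := C_good _ CA.
    by case: (M s t (or_introl As) (or_intror S0t)) => ?;
      [left; exists A|right].
  - have [M _] := C_good _ CB.
    by case: (M s t (or_intror S0s) (or_introl Bt)) => ?;
      [left; exists B|right].
pose S := A `|` S0; have S1 : S 1 by right.
exists S; split=> // [s|a nSa]; first by right.
apply: contrapT => no_ann.
pose B : set R := [set x | exists n s, S s /\ x = s * a ^+ n].
have SB : S `<=` B by move=> s Ss; exists 0%N, s; rewrite expr0 mulr1.
apply: (A_max B).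
  split=> [x Ax|BA]; first by apply: SB; left.
  by apply: nSa; left; apply: BA; exists 1%N, 1; rewrite expr1 mul1r.
have BS0 : B `|` S0 = B by apply/setUidPl => x S0x; apply: SB; right.
rewrite /good BS0; split.
  move=> _ _ [n [s [Ss ->]]] [k [t [St ->]]].
  by exists (n + k)%N, (s * t); split; [exact: AM | rewrite exprD mulrACA].
move=> [n [s [Ss]]] /esym e.
apply: no_ann; exists s => //; apply: (R_reduced (n := n.+1)).
have -> : (s * a) ^+ n.+1 = s * a ^+ n * (s ^+ n * a)
  by rewrite exprMn exprS (exprSr a) mulrACA.
by rewrite e mul0r.
Qed.

(** The complement of a maximal multiplicative set S is the set of the
    elements killed by an element of S.  It is therefore an ideal, prime
    since S is multiplicative, and no smaller ideal is prime: a prime ideal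
    avoiding S contains every element killed by an element of S. *)
Lemma minimal_prime_avoiding (S0 : set R) :
  S0 1 -> (forall s t, S0 s -> S0 t -> S0 (s * t)) -> ~ S0 0 ->
  exists P : spectrum R, [/\ minimal_primes P,
    forall s, S0 s -> ~ spec_ideal P s &
    forall a, spec_ideal P a -> exists2 s, ~ spec_ideal P s & s * a = 0].
Proof.
move=> S01 S0M S00.
have [S [S0S SM S_0 S_ann]] := maximal_multiplicative S01 S0M S00.
have PE a : ~ S a <-> exists2 s, S s & s * a = 0.
  by split=> [/S_ann//|[s Ss sa Sa]]; apply: S_0; rewrite -sa; apply: SM.
have P_prime : prime_ideal (~` S).
  split.
  - split=> // a x y /PE[s Ss sx] /PE[t St ty]; apply/PE; exists (s * t);
      first exact: SM.
    have -> : s * t * (a * x + y) = a * t * (s * x) + s * (t * y) by ring.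
    by rewrite sx ty !mulr0 addr0.
  - by apply; apply: S0S.
  - move=> a b nSab; case: (pselect (S a)) => [Sa|]; last by left.
    by right=> Sb; apply: nSab; apply: SM.
exists (Spectrum P_prime); split=> [P' P'P a Pa|s S0s|a /PE[s Ss sa]] /=.
- have [s Ss sa] := (PE a).1 Pa.
  have [[P'0 _] _ P'M] := spec_prime P'.
  have : spec_ideal P' (s * a) by rewrite sa.
  by case/P'M => // /P'P /(_ Ss).
- by apply; apply: S0S.
- by exists s => //; apply.
Qed.

(** The localization of a reduced ring at a minimal prime is a field.  The
    complement of P yields a minimal prime with this property inside P, hence
    equal to P. *)
Lemma minimal_prime_annihilator (P : spectrum R) a :
  minimal_primes P -> spec_ideal P a ->
  exists2 s, ~ spec_ideal P s & s * a = 0.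
Proof.
move=> P_min Pa; have [P_id P1 PM] := spec_prime P.
have [|s t nPs nPt /PM[]//||P' [_ PP' P'ann]] := @minimal_prime_avoiding (~` P).
- exact: P1.
- by apply; apply: (submod0 P_id).
have sub : P' `<=` P by move=> x P'x; apply: contrapT => /PP'.
have [s nP's sa] := P'ann a (P_min _ sub _ Pa); exists s => // Ps.
exact: nP's (P_min _ sub _ Ps).
Qed.

(** In R_P the annihilator of 1 is P.  Single projectivity writes 1 as a
    combination whose coefficients are all killed by P; they cannot all lie
    in P, since elements of P act as 0 on R_P. *)
Lemma minimal_prime_isolated (P : spectrum R) :
  (forall M : lmodType R, flat M -> singly_projective M) ->
  minimal_primes P ->
  exists2 b, ~ spec_ideal P b & forall a, spec_ideal P a -> a * b = 0.
Proof.
move=> sp P_min; have [P_id P1 PM] := spec_prime P.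
have SM s t : (~` P) s -> (~` P) t -> (~` P) (s * t) by move=> nPs nPt /PM[].
pose one : localization (P1 : (~` P) 1) SM (R^o : lmodType R) :=
  lfrac (P1 : (~` P) 1) SM (1 : R^o) (denom (P1 : (~` P) 1)).
have [l [oneE lE]] :=
  singly_projective_coefficients one (sp _ (@localization_flat R (~` P) P1 SM)).
(* If all coefficients were in P, then 1 would be 0 in R_P. *)
have [z zl nPz] : exists2 z, z \in l & ~ spec_ideal P z.1.
  apply: contrapT => nz; have : one = 0.
    rewrite oneE big_seq big1 // => -[b x] zl /=.
    have Pb : spec_ideal P b by apply: contrapT => nPb; apply: nz;
      exists (b, x).
    have [s nPs sb] := minimal_prime_annihilator P_min Pb.
    elim/lfrac_ind: x zl => r t _; rewrite lfracZ; apply/lfrac_eq0;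
      exists s => //.
    by rewrite scalerA sb scale0r.
  move=> /lfrac_eq0[s nPs]; rewrite [_ *: _]mulr1 => s0; apply: nPs.
  by rewrite s0; apply: (submod0 P_id).
exists z.1 => // a Pa; apply: lE zl.
have [s nPs sa] := minimal_prime_annihilator P_min Pa.
by rewrite lfracZ; apply/lfrac_eq0; exists s => //; rewrite scalerA sa scale0r.
Qed.

(** A prime ideal not containing b contains P, as b P = 0; hence elements
    outside it are outside P.  Applied at a cluster point to primes avoiding
    the d n, this puts infinitely many d n outside one prime ideal. *)
Lemma compact_isolated_no_orthogonal (d : nat -> R) :
  compact (@minimal_primes R) ->
  (forall P : spectrum R, minimal_primes P ->
     exists2 b, ~ spec_ideal P b & forall a, spec_ideal P a -> a * b = 0) ->
  ~ orthogonal_sequence d.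
Proof.
move=> cpt isol [d0 d_orth].
have /choice[P PE] n :
    exists P : spectrum R, minimal_primes P /\ ~ spec_ideal P (d n).
  have [|||P [P_min Pd _]] :=
    @minimal_prime_avoiding [set x | exists k, x = d n ^+ k].
  - by exists 0%N; rewrite expr0.
  - by move=> _ _ [i ->] [j ->]; exists (i + j)%N; rewrite exprD.
  - by move=> [k /esym/R_reduced dn]; move: (d0 n); rewrite dn eqxx.
  - by exists P; split=> //; apply: Pd; exists 1%N; rewrite expr1.
have [|Q [Q_min Q_cl]] := cpt (P @ \oo) _.
  by exists 0%N => // n _; have [] := PE n.
have [b nQb Qb] := isol Q Q_min.
(* The primes not containing b form a neighbourhood of the cluster point Q. *)
have frequently N : exists2 n, (N <= n)%N & ~ spec_ideal Q (d n).
  have [||_ [[n Nn <-] nPb]] :=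
    Q_cl (P @` [set n | (N <= n)%N]) [set P' | ~ spec_ideal P' b].
  - by exists N => // n Nn; exists n.
  - apply: open_nbhs_nbhs; split=> //; exists [set b]; apply/seteqP;
      split=> P' /=.
      by move=> nP'b sub; apply: nP'b; apply: sub.
    by move=> nsub P'b; apply: nsub => _ ->.
  exists n => // Qd; have [[P0 _] _ PM] := spec_prime (P n).
  have : spec_ideal (P n) (d n * b) by rewrite Qb.
  by case/PM => //; have [] := PE n.
have [n _ nQn] := frequently 0%N; have [k nk nQk] := frequently n.+1.
have [[Q0 _] _ QM] := spec_prime Q.
have : spec_ideal Q (d n * d k) by rewrite d_orth // ltn_eqF.
by case/QM.
Qed.

End MinimalPrimes.

(** * The equivalence *)

Theorem corollary3p2 (R : comPzRingType) (R_reduced : reduced R)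
    (MinR_compact : compact (@minimal_primes R)) :
  [<-> semisimple_ring (total_fractions R);
       forall M : lmodType R, flat M -> semi_compact M;
       forall M : lmodType R, flat M -> finitely_projective M;
       forall M : lmodType R, flat M -> singly_projective M].
Proof.
split; last split; last split.
- move=> Q_ss M; apply: flat_semi_compact.
  exact: semisimple_ideals_split.
- move=> flat_sc M; apply: flat_finitely_projective.
  apply: no_orthogonal_sequence_split => // d.
  apply: semi_compact_no_orthogonal => //.
  exact/flat_sc/finsupp_flat.
- move=> flat_fp M M_flat N [g gen]; apply: (flat_fp M M_flat).
  exists 1%N, (fun=> g) => x; have [r ->] := gen x.
  by exists (fun=> r); rewrite big_ord1.
- move=> flat_sp; apply: ideals_split_semisimple.
  apply: no_orthogonal_sequence_split => // d.
  apply: compact_isolated_no_orthogonal => // P.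
  exact: minimal_prime_isolated.
Qed.
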